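(* Let $p>2$ be a prime, let $\mu$ be the alternating measure on $\mathbb{Z}_p$, and let $E_{1,2}$ be the regularization with parameter $c=2$ of the first Bernoulli distribution $E_1$ on $\mathbb{Z}_p$. Then $$\tfrac{1}{2}\,\mu = E_{1,2}.$$ That is, $E_{1,2}(a+p^n\mathbb{Z}_p)=\tfrac12\,\mu(a+p^n\mathbb{Z}_p)$ for every clopen ball $a+p^n\mathbb{Z}_p$ of $\mathbb{Z}_p$.
   Context: For $x\in\mathbb{Z}_p$ and an integer $n\ge 0$, $\{x\}_{p^n}$ denotes the unique integer in $\{0,1,\dots,p^n-1\}$ congruent to $x$ modulo $p^n\mathbb{Z}_p$. Bernoulli distributions: for an integer $k\ge 0$, the distribution $E_k$ on $\mathbb{Z}_p$ is defined on clopen balls by $$E_k(a+p^n\mathbb{Z}_p)=p^{n(k-1)}B_k\!\left(\frac{\{a\}_{p^n}}{p^n}\right),$$ where $B_k(x)$ is the $k$-th Bernoulli polynomial; in particular $B_1(x)=x-\frac12$. Regularization: for $c\in\mathbb{Z}$ with $c\ne 1$ and $c\notin p\mathbb{Z}$, the regularization $E_{k,c}$ of $E_k$ is $$E_{k,c}(a+p^n\mathbb{Z}_p)=E_k(a+p^n\mathbb{Z}_p)-c^k\,E_k\!\left(\left\{\frac{a}{c}\right\}_{p^n}+p^n\mathbb{Z}_p\right),$$ where $a/c\in\mathbb{Z}_p$ since $c$ is a $p$-adic unit. Alternating measure (for $p\neq 2$): $\mu(a+p^n\mathbb{Z}_p)=(-1)^{\{a\}_{p^n}}$ on clopen balls.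 *)

(* Defs.v *)
From HB Require Import structures.
From mathcomp Require Import all_boot all_order all_algebra.
From mathcomp Require Import boolp classical_sets.

Set Implicit Arguments.
Unset Strict Implicit.
Unset Printing Implicit Defensive.

Import Order.TTheory GRing.Theory Num.Theory.
Local Open Scope ring_scope.

(* The ring of p-adic integers, as the inverse limit of the rings Z/p^n. An   *)
(* element x is its compatible family of residues: [res x n] is the unique    *)
(* integer in {0, ..., p^n - 1} congruent to x modulo p^n, i.e. {x}_{p^n}.    *)
Record padicInt (p : nat) (hp : prime p) : Type := PadicInt {
  res : nat -> nat;
  _ : forall n, res n = (res n.+1 %% p ^ n)%N }.

Section PadicInt.
Variables (p : nat) (hp : prime p).
Local Notation Zp := (padicInt hp).
Implicit Types (x y z : Zp).

HB.instance Definition _ := gen_eqMixin Zp.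
HB.instance Definition _ := gen_choiceMixin Zp.

Lemma padic_eqP x y : (forall n, res x n = res y n) -> x = y.
Proof.
case: x y => [u hu] [v hv] /= /funext uv; rewrite uv in hu *.
by congr PadicInt.
Qed.

Lemma res_lt x n : (res x n < p ^ n)%N.
Proof. by case: x => u hu /=; rewrite hu ltn_mod expn_gt0 prime_gt0. Qed.

Lemma res_small x n : (res x n %% p ^ n)%N = res x n.
Proof. by rewrite modn_small ?res_lt. Qed.

Lemma res_mod x m n : (m <= n)%N -> (res x n %% p ^ m)%N = res x m.
Proof.
elim: n => [|n IHn]; first by rewrite leqn0 => /eqP->; rewrite res_small.
rewrite leq_eqVlt => /predU1P[->|]; first by rewrite res_small.
rewrite ltnS => le_mn; rewrite -IHn //.
by case: (x) => u hu /=; rewrite (hu n) modn_dvdm ?dvdn_exp2l.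
Qed.

Lemma padicMk_subproof (f : nat -> nat) :
  (forall n, f n.+1 = f n %[mod p ^ n]) ->
  forall n, (f n %% p ^ n = f n.+1 %% p ^ n.+1 %% p ^ n)%N.
Proof. by move=> hf n; rewrite modn_dvdm ?dvdn_exp2l // hf. Qed.

Definition padicMk (f : nat -> nat)
    (hf : forall n, f n.+1 = f n %[mod p ^ n]) : Zp :=
  @PadicInt p hp (fun n => f n %% p ^ n)%N (padicMk_subproof hf).

Lemma resS x n : res x n.+1 = res x n %[mod p ^ n].
Proof. by rewrite res_small res_mod. Qed.

Fact padic_nat_subproof k n : k = k %[mod p ^ n].
Proof. by []. Qed.
Definition padic_nat (k : nat) : Zp := padicMk (padic_nat_subproof k).

Fact padic_add_subproof x y n :
  (res x n.+1 + res y n.+1 = res x n + res y n %[mod p ^ n])%N.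
Proof. by rewrite -modnDm !resS modnDm. Qed.
Definition padic_add x y : Zp := padicMk (padic_add_subproof x y).

Fact padic_mul_subproof x y n :
  (res x n.+1 * res y n.+1 = res x n * res y n %[mod p ^ n])%N.
Proof. by rewrite -modnMm !resS modnMm. Qed.
Definition padic_mul x y : Zp := padicMk (padic_mul_subproof x y).

Fact padic_opp_subproof x n :
  (p ^ n.+1 - res x n.+1 = p ^ n - res x n %[mod p ^ n])%N.
Proof.
apply/eqP; rewrite -(eqn_modDr (res x n)) subnK; last exact/ltnW/res_lt.
rewrite -modnDmr -[in X in X == _]resS modnDmr subnK; last exact/ltnW/res_lt.
by rewrite expnS modnMl modnn.
Qed.
Definition padic_opp x : Zp := padicMk (padic_opp_subproof x).

Fact padic_addA : associative padic_add.
Proof. by move=> x y z; apply: padic_eqP => n /=; rewrite modnDml modnDmr addnA. Qed.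
Fact padic_addC : commutative padic_add.
Proof. by move=> x y; apply: padic_eqP => n /=; rewrite addnC. Qed.
Fact padic_add0 : left_id (padic_nat 0) padic_add.
Proof. by move=> x; apply: padic_eqP => n /=; rewrite mod0n add0n res_small. Qed.
Fact padic_addN : left_inverse (padic_nat 0) padic_opp padic_add.
Proof.
move=> x; apply: padic_eqP => n /=.
by rewrite modnDml subnK ?modnn ?mod0n //; apply/ltnW/res_lt.
Qed.

HB.instance Definition _ :=
  GRing.isZmodule.Build Zp padic_addA padic_addC padic_add0 padic_addN.

Fact padic_mulA : associative padic_mul.
Proof. by move=> x y z; apply: padic_eqP => n /=; rewrite modnMml modnMmr mulnA. Qed.
Fact padic_mulC : commutative padic_mul.
Proof. by move=> x y; apply: padic_eqP => n /=; rewrite mulnC. Qed.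
Fact padic_mul1 : left_id (padic_nat 1) padic_mul.
Proof. by move=> x; apply: padic_eqP => n /=; rewrite modnMml mul1n res_small. Qed.
Fact padic_mulD : left_distributive padic_mul padic_add.
Proof. by move=> x y z; apply: padic_eqP => n /=; rewrite modnMml modnDm mulnDl. Qed.
Fact padic_1neq0 : padic_nat 1 != 0.
Proof.
apply/eqP => /(congr1 (fun x => res x 1)) /=.
by rewrite mod0n expn1 modn_small // prime_gt1.
Qed.

HB.instance Definition _ := GRing.Zmodule_isComNzRing.Build Zp
  padic_mulA padic_mulC padic_mul1 padic_mulD padic_1neq0.

Definition padic_unit : {pred Zp} := [pred x | `[< exists y, y * x = 1 >]].
Definition padic_inv x : Zp := xget x [set y | y * x = 1]%classic.

Fact padic_mulV : {in padic_unit, left_inverse 1 padic_inv *%R}.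
Proof. by move=> x /asboolP x_unit; apply: (xgetPex x x_unit). Qed.
Fact padic_unitP x y : y * x = 1 -> padic_unit x.
Proof. by move=> yx; apply/asboolP; exists y. Qed.
Fact padic_inv_out : {in [predC padic_unit], padic_inv =1 id}.
Proof.
move=> x /asboolPn x_nunit; apply: xgetPN => y yx.
by apply: x_nunit; exists y.
Qed.

HB.instance Definition _ := GRing.ComNzRing_hasMulInverse.Build Zp
  padic_mulV padic_unitP padic_inv_out.

Lemma res0 n : res (0 : Zp) n = 0%N.
Proof. exact: mod0n. Qed.

Lemma resD x y n : res (x + y) n = ((res x n + res y n) %% p ^ n)%N.
Proof. by []. Qed.

Lemma resM x y n : res (x * y) n = ((res x n * res y n) %% p ^ n)%N.
Proof. by []. Qed.

Lemma res_nat k n : res (k%:R : Zp) n = (k %% p ^ n)%N.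
Proof.
elim: k => [|k IHk]; first by rewrite res0 mod0n.
by rewrite mulrS resD IHk [res 1 n]/= modnDm add1n.
Qed.

Lemma padic_unit_int (c : int) :
  ~~ (p%:Z %| c)%Z -> (c%:~R : Zp) \is a GRing.unit.
Proof.
have nat_unit k : coprime p k -> (k%:R : Zp) \is a GRing.unit.
  move=> pk; have k_gt0 : (0 < k)%N.
    by case: k pk => //; rewrite /coprime gcdn0 => /eqP p1; move: hp; rewrite p1.
  pose f n := (egcdn k (p ^ n)).1.
  have fK n : f n * k = 1 %[mod p ^ n].
    rewrite /f; case: egcdnP => //= a b; rewrite gcdnC.
    by rewrite (eqP (coprimeXl n pk)) => -> _; rewrite modnMDl.
  have hf n : f n.+1 = f n %[mod p ^ n].
    have fSK : f n.+1 * k = 1 %[mod p ^ n].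
      have dvd_p : (p ^ n %| p ^ n.+1)%N by rewrite dvdn_exp2l.
      by rewrite -(modn_dvdm _ dvd_p) fK modn_dvdm.
    transitivity ((f n.+1 * (f n * k)) %% p ^ n)%N.
      by rewrite -[RHS]modnMmr fK modnMmr muln1.
    by rewrite mulnCA -[LHS]modnMmr fSK modnMmr muln1.
  apply/unitrPr; exists (padicMk hf); apply: padic_eqP => n.
  by rewrite resM res_nat modnMm [res 1 n]/= mulnC fK.
rewrite /dvdz /= -prime_coprime // => /nat_unit.
by case: c => n //=; rewrite NegzE mulrNz unitrN.
Qed.

(* The ball a + p^n Z_p.                                                      *)
Definition zball (a : Zp) (n : nat) : set Zp :=
  [set x | exists y, x = a + (p ^ n)%:R * y]%classic.

Lemma zballE a n x : zball a n x <-> res x n = res a n.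
Proof.
split=> [[y ->]|xa].
  by rewrite resD resM res_nat modnn mul0n mod0n addn0 res_small.
pose z := x - a; have z0 : res z n = 0%N.
  have : res z n == 0 %[mod p ^ n].
    by rewrite -(eqn_modDr (res a n)) add0n -resD subrK xa res_small.
  by rewrite mod0n res_small => /eqP.
have xE : x = a + z by rewrite addrC subrK.
move: z z0 xE => z z0 ->; have dvd_z m : (p ^ n %| res z (n + m))%N.
  by rewrite /dvdn res_mod ?leq_addr // z0.
have pn_gt0 : (0 < p ^ n)%N by rewrite expn_gt0 prime_gt0.
have hf m : (res z (n + m.+1) %/ p ^ n = res z (n + m) %/ p ^ n %[mod p ^ m])%N.
  apply/eqP; rewrite -(eqn_pmul2l pn_gt0) !muln_modr -!expnD.
  by rewrite ![(p ^ n * _)%N]mulnC !divnK // addnS resS.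
exists (padicMk hf); congr (_ + _).
apply: padic_eqP => m; rewrite resM res_nat modnMml /=.
rewrite -(res_mod z (leq_addl n m)) -[in LHS](divnK (dvd_z m)) mulnC.
by rewrite modnMmr.
Qed.

Lemma zball_inj a b n m : zball a n = zball b m -> n = m /\ res a n = res b n.
Proof.
have step c d k l : zball c k = zball d l -> (l <= k)%N.
  move=> eqB; rewrite leqNgt; apply/negP => lt_kl.
  have h x : res x k = res c k -> res x l = res d l.
    by move/(zballE c k x); rewrite eqB => /(zballE d l x).
  have /h : res (c + (p ^ k)%:R) k = res c k.
    by rewrite resD res_nat modnn addn0 res_small.
  rewrite -(h c erefl) resD res_nat modnDmr => /eqP.
  rewrite -[X in _ == X]res_small -[X in _ == X %[mod _]]addn0 eqn_modDl mod0n.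
  rewrite modn_small ?ltn_exp2l ?prime_gt1 // expn_eq0.
  by rewrite -leqn0 leqNgt prime_gt0.
move=> eqB; have nm : n = m.
  by apply/eqP; rewrite eqn_leq (step _ _ _ _ eqB) (step _ _ _ _ (esym eqB)).
split=> //; subst m; apply/(zballE b n a); rewrite -eqB; exact/zballE.
Qed.

(* A distribution is given by its values on the balls of Z_p. [on_balls f] is *)
(* the function of a set U with value [f a n] when U = a + p^n Z_p, provided  *)
(* f a n depends on a only modulo p^n (see [on_ballsE]); sets that are not    *)
(* balls get the dummy value 0.                                               *)
Definition on_balls (f : Zp -> nat -> rat) (U : set Zp) : rat :=
  xget 0 [set r | exists a n, U = zball a n /\ r = f a n]%classic.

Lemma on_ballsE (f : Zp -> nat -> rat) a n :
  (forall x y m, res x m = res y m -> f x m = f y m) ->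
  on_balls f (zball a n) = f a n.
Proof.
move=> hf; apply: xget_unique; first by exists a, n.
by move=> _ [b [m [/zball_inj[<- /hf ->] ->]]].
Qed.

End PadicInt.

Fixpoint bernoulli_seq (n : nat) : seq rat :=
  if n is m.+1 then
    let s := bernoulli_seq m in
    rcons s (((m == 0)%:R - \sum_(j < m) 'C(m.+1, j)%:R * s`_j) / m.+1%:R)
  else [::].

Definition bernoulli (n : nat) : rat := (bernoulli_seq n.+1)`_n.

Lemma size_bernoulli_seq n : size (bernoulli_seq n) = n.
Proof. by elim: n => //= n IHn; rewrite size_rcons IHn. Qed.

Lemma nth_bernoulli_seq n j : (j < n)%N -> (bernoulli_seq n)`_j = bernoulli j.
Proof.
elim: n => // n IHn; rewrite ltnS leq_eqVlt => /predU1P[->//|lt_jn].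
by rewrite /= nth_rcons size_bernoulli_seq lt_jn IHn.
Qed.

Lemma bernoulli_rec n :
  \sum_(j < n.+1) 'C(n.+1, j)%:R * bernoulli j = (n == 0)%:R.
Proof.
rewrite big_ord_recr /= binSn {2}/bernoulli /= nth_rcons size_bernoulli_seq.
rewrite ltnn eqxx mulrC divfK ?pnatr_eq0 //.
under [X in _ + (_ - X)]eq_bigr => j _ do rewrite nth_bernoulli_seq //.
by rewrite addrC subrK.
Qed.

Definition bernoulli_poly (k : nat) : {poly rat} :=
  \sum_(j < k.+1) ('C(k, j)%:R * bernoulli j) *: 'X^(k - j).

Section Distributions.
Variables (p : nat) (hp : prime p).
Local Notation Zp := (padicInt hp).

Definition bernoulli_distr (k : nat) : set Zp -> rat :=
  on_balls (fun a n =>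
    p%:R ^ (n%:Z * (k%:Z - 1)) *
      (bernoulli_poly k).[(res a n)%:R / (p ^ n)%:R]).

(* Meaningful for c != 1 and p not dividing c; then c is a unit of Z_p (see   *)
(* [padic_unit_int]) and a / c%:~R is the quotient in Z_p.                    *)
Definition bernoulli_reg (k : nat) (c : int) : set Zp -> rat :=
  on_balls (fun a n =>
    bernoulli_distr k (zball a n) -
    c%:~R ^+ k * bernoulli_distr k (zball (res (a / c%:~R) n)%:R n)).

Definition alternating_distr : set Zp -> rat :=
  on_balls (fun a n => (-1) ^+ res a n).

Lemma bernoulli_distrE k a n : bernoulli_distr k (zball a n) =
  p%:R ^ (n%:Z * (k%:Z - 1)) *
    (bernoulli_poly k).[(res a n)%:R / (p ^ n)%:R].
Proof. by rewrite /bernoulli_distr on_ballsE // => x y m ->. Qed.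

Lemma bernoulli_regE k c a n : bernoulli_reg k c (zball a n) =
  bernoulli_distr k (zball a n) -
  c%:~R ^+ k * bernoulli_distr k (zball (res (a / c%:~R) n)%:R n).
Proof.
rewrite /bernoulli_reg on_ballsE // => x y m xy.
by rewrite !bernoulli_distrE !resM xy.
Qed.

Lemma alternating_distrE a n : alternating_distr (zball a n) = (-1) ^+ res a n.
Proof. by rewrite /alternating_distr on_ballsE // => x y m ->. Qed.

End Distributions.

(* Main.v *)
(* With q = p ^ n, r = {a}_q and b = {a/2}_q, the left side is                *)
(* (r - 2b)/q + 1/2. Since 2b = r mod q and 0 <= r, b < q, either 2b = r or   *)
(* 2b = r + q; as q is odd, the parity of r tells which case occurs.          *)
Require Import Defs.
From mathcomp Require Import all_boot all_order all_algebra.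
From mathcomp Require Import boolp classical_sets.
From mathcomp Require Import ring zify.
Import GRing.Theory.
Local Open Scope ring_scope.

(** For [k = 1] the power of [p] is 1 and [bernoulli_poly1E] makes both values of $E_1$ affine in
    the residues. By [res_half], $2b - r$ is 0 for even $r$ and $q$ for odd $r$, so $(r - 2b)/q +
    1/2$ is $1/2$ or $-1/2$, that is $(-1)^r/2$. *)

Lemma bernoulli_poly1E (x : rat) : (bernoulli_poly 1).[x] = x - 2^-1.
Proof.
have B0 : bernoulli 0 = 1.
  by have := bernoulli_rec 0; rewrite big_ord1 mul1r.
have B1 : bernoulli 1 = - 2^-1.
  have := bernoulli_rec 1; rewrite big_ord_recr big_ord1 /= B0 bin0 bin1 mul1r.
  by move/eqP; rewrite addrC addr_eq0 => /eqP /(canRL (mulKf _)) -> //; rewrite mulrN1.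
rewrite /bernoulli_poly big_ord_recr big_ord1 /= B0 B1 bin0 binn !mul1r.
by rewrite subnn subn0 expr0 scale1r !hornerE.
Qed.

Lemma res_half (p : nat) (hp : prime p) (p_gt2 : (2 < p)%N)
    (a : padicInt hp) (n : nat) :
  (2 * res (a / 2) n = res a n + odd (res a n) * p ^ n)%N.
Proof.
have p_odd : odd p by case: (even_prime hp) p_gt2 => // ->.
have unit2 : (2 : padicInt hp) \is a GRing.unit.
  apply: (@padic_unit_int p hp 2); rewrite /dvdz /=.
  by apply/negP => /dvdn_leq /= /(_ isT); rewrite leqNgt p_gt2.
have q_odd : odd (p ^ n) by rewrite oddX p_odd orbT.
have /(congr1 (fun x => res x n)) : a / 2 * 2 = a by rewrite divrK.
rewrite resM res_nat modnMmr.
have := res_lt (a / 2) n; have := res_lt a n.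
move: (res a n) (res (a / 2) n) (p ^ n)%N q_odd => r b q q_odd r_lt b_lt rE.
have [b_small|b_large] := ltnP (b * 2) q.
  (* No wrap-around: [r] is [2b] itself, hence even. *)
  by move: rE; rewrite modn_small // => <-; rewrite oddM andbF mul0n addn0 mulnC.
have bE : (b * 2 = r + q)%N.
  (* As [b < q], [2b < 2q], so removing [q] once gives the residue. *)
  move: rE; rewrite -{1}(subnK b_large) modnDr modn_small; lia.
have r_odd : odd r.
  (* [r + q] is even and [q] odd. *)
  by have := congr1 odd bE; rewrite oddM oddD q_odd andbF; case: (odd r).
by rewrite r_odd mul1n mulnC.
Qed.

Theorem theorem2p2 (p : nat) (hp : prime p) (p_gt2 : (2 < p)%N)
    (a : padicInt hp) (n : nat) :
  bernoulli_reg 1 2 (zball a n) = 2^-1 * alternating_distr (zball a n).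
Proof.
rewrite bernoulli_regE alternating_distrE !bernoulli_distrE !bernoulli_poly1E.
rewrite subrr mulr0 expr0z !mul1r expr1 res_nat res_small.
have q_neq0 : (p ^ n)%:R != 0 :> rat.
  by rewrite Num.Theory.pnatr_eq0 -lt0n expn_gt0 prime_gt0.
have := congr1 (fun k => k%:R : rat) (res_half p hp p_gt2 a n).
(* The sign is put in terms of [odd (res a n)], the bit that also occurs in [bE]. *)
rewrite /= natrM natrD natrM -[(-1) ^+ res a n]signr_odd => bE.
rewrite mulrBr mulrA bE.
by case: (odd _); rewrite ?mulr1n ?mulr0n ?expr1 ?expr0; field.
Qed.
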